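(* Let $D$ be an uncertain quantitative database over a finite item set $I$, let $\alpha\in(0,1]$, $\beta$, $\gamma$ be the minimum support, utility occupancy and probability thresholds, and let $\prec$ be the support-ascending total order on $I$. Let $X$ be a nonempty itemset, viewed as a node of the SC-tree, and let $m=\lceil \alpha|D|\rceil$. Let $\hat\phi(X)$ be $\frac1m$ times the sum of the $m$ largest values (all values, if there are fewer than $m$) of the family $\bigl(uo(X,T_k)+ruo(X,T_k)\bigr)_{T_k\in\Gamma_X}$. If $\hat\phi(X)<\beta$, then all descendants of $X$ in the SC-tree can be pruned; that is, no descendant $Y$ of $X$ in the SC-tree is a potential high utility-occupancy pattern with respect to $\alpha,\beta,\gamma$.
   Context: An uncertain quantitative database is a nonempty finite collection $D=\{T_1,\dots,T_n\}$ of transactions, with $|D|=n$. Each transaction $T_k$ is a nonempty subset of a finite item set $I$. Each item $i\in T_k$ carries a quantity $q(i,T_k)$ (a positive integer) and an existence probability $p(i,T_k)\in(0,1]$. Each item $i\in I$ has a unit utility $p(i)>0$. An itemset is a subset $X\subseteq I$. Put $\Gamma_X=\{T_k\in D: X\subseteq T_k\}$ and $SC(X)=|\Gamma_X|$ (the support count). Utility: $u(i,T_k)=p(i)\,q(i,T_k)$ for $i\in T_k$; $u(X,T_k)=\sum_{i\in X}u(i,T_k)$ for $X\subseteq T_k$; $tu(T_k)=\sum_{i\in T_k}u(i,T_k)$. Utility occupancy: $uo(X,T_k)=u(X,T_k)/tu(T_k)$ for $X\subseteq T_k$ (and $uo(i,T_k)=uo(\{i\},T_k)$), and $uo(X)=\frac{1}{|\Gamma_X|}\sum_{T_k\in\Gamma_X}uo(X,T_k)$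 when $\Gamma_X\neq\emptyset$. Probability: $p(X,T_k)=\prod_{i\in X}p(i,T_k)$ for $X\subseteq T_k$, and $pro(X)=\sum_{T_k\in\Gamma_X}p(X,T_k)$. The order $\prec$ is a total order on $I$ in which items are listed by ascending support count $SC(\{i\})$ (ties broken arbitrarily but in a fixed way). For an itemset $X$ and item $i$, $X\prec i$ means that every item of $X$ precedes $i$. Remaining utility occupancy: $ruo(X,T_k)=\sum_{i\in T_k,\ i\notin X,\ X\prec i}uo(i,T_k)$ for $X\subseteq T_k$. The SC-tree is the set-enumeration tree of $I$ with respect to $\prec$: its root is $\emptyset$, its nodes are the itemsets, and the children of a node $X$ are the itemsets $X\cup\{i\}$ with $i\in I\setminus X$ and $X\prec i$. Thus the descendants of $X$ are the itemsets $X\cup Z$ with $Z\neq\emptyset$ and $X\prec i$ for all $i\in Z$. An itemset $X$ is a potential high utility-occupancy pattern (PHUOP) if $SC(X)\ge\alpha|D|$, $uo(X)\ge\beta$ and $pro(X)\ge\gamma$. *)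

(* Defs.v *)
From mathcomp Require Import all_boot all_order all_algebra.
From mathcomp Require Import reals.

Set Implicit Arguments.
Unset Strict Implicit.
Unset Printing Implicit Defensive.

Import Order.TTheory GRing.Theory Num.Theory.

Local Open Scope ring_scope.

(* The transactions form an indexed family, so two of them may have the same
   items. The values of [qty] and [prob] at [(i, k)] are meaningful only when
   [i \in trans k]. *)
Record uqdb (R : realType) (I : finType) := Uqdb {
  dbsize : nat;
  dbsize_gt0 : (0 < dbsize)%N;
  trans : 'I_dbsize -> {set I};
  trans_neq0 : forall k, trans k != set0;
  qty : I -> 'I_dbsize -> nat;
  qty_gt0 : forall i k, i \in trans k -> (0 < qty i k)%N;
  prob : I -> 'I_dbsize -> R;
  prob_itv : forall i k, i \in trans k -> 0 < prob i k <= 1;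
  unit_utility : I -> R;
  unit_utility_gt0 : forall i, 0 < unit_utility i
}.

Section UtilityOccupancy.
Variables (R : realType) (I : finType) (D : uqdb R I).
Implicit Types (X Y : {set I}) (i : I) (k : 'I_(dbsize D)).

Definition supporting X : {set 'I_(dbsize D)} := [set k | X \subset trans k].

Definition support_count X : nat := #|supporting X|.

Definition item_utility i k : R := unit_utility D i * (qty i k)%:R.

(* The functions of a pair [(X, k)] below are total; they are meaningful, and
   used, only when [X \subset trans k]. *)
Definition utility X k : R := \sum_(i in X) item_utility i k.

Definition trans_utility k : R := \sum_(i in trans k) item_utility i k.

Definition uo_trans X k : R := utility X k / trans_utility k.

(* Equal to [0] when [supporting X] is empty, since [0^-1 = 0]; such an [X]
   cannot reach a positive minimum support. *)
Definition uo X : R :=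
  (support_count X)%:R^-1 * \sum_(k in supporting X) uo_trans X k.

Definition prob_trans X k : R := \prod_(i in X) prob i k.

Definition pro X : R := \sum_(k in supporting X) prob_trans X k.

Definition phuop (alpha beta gamma : R) X : bool :=
  [&& alpha * (dbsize D)%:R <= (support_count X)%:R,
      beta <= uo X & gamma <= pro X].

(* [prec] is the strict part of the order. *)
Definition support_ascending (prec : rel I) : Prop :=
  [/\ irreflexive prec, transitive prec,
      forall i j, i != j -> prec i j || prec j i &
      forall i j, prec i j -> (support_count [set i] <= support_count [set j])%N].

Definition all_before (prec : rel I) X i : bool := [forall x in X, prec x i].

Definition ruo_trans (prec : rel I) X k : R :=
  \sum_(i in trans k | (i \notin X) && all_before prec X i)
     uo_trans [set i] k.

Definition sc_child (prec : rel I) : rel {set I} := fun X Y =>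
  [exists i, [&& i \notin X, all_before prec X i & Y == i |: X]].

(* A descendant is a node reached by at least one child step. *)
Definition sc_descendant (prec : rel I) : rel {set I} := fun X Y =>
  [exists C, sc_child prec X C && connect (sc_child prec) C Y].

(* [Num.ceil] is integer-valued; [absz] only casts to [nat] here, as
   [alpha >= 0]. *)
Definition min_count (alpha : R) : nat :=
  `|Num.ceil (alpha * (dbsize D)%:R)|%N.

Definition phi_hat (prec : rel I) (alpha : R) X : R :=
  (min_count alpha)%:R^-1 *
  \sum_(v <- take (min_count alpha)
               (sort >=%R [seq uo_trans X k + ruo_trans prec X k
                          | k <- enum (supporting X)])) v.

End UtilityOccupancy.

(* Main.v *)
Require Import Defs.
From mathcomp Require Import all_boot all_order all_algebra.
From mathcomp Require Import reals.

Import Order.TTheory GRing.Theory Num.Theory.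
Local Open Scope ring_scope.

(** If a descendant Y of X is a PHUOP, then Y is supported by at least m
    transactions, all of which support X, and uo(Y, T) <= uo(X, T) + ruo(X, T)
    on each of them because the items of Y \ X come after those of X. So uo(Y)
    is at most the average of uo(X, T) + ruo(X, T) over at least m of the
    transactions supporting X, hence at most the average of the m largest
    values. *)

(** The threshold [nth 0 s m.-1] is the [m]-th largest value, as positions start at 0. The first [m]
    entries are at least the threshold and the later ones at most, so the maxima are [v] minus the
    threshold on the former and 0 on the latter. The last sum ignores the order of [s], so it can be
    taken over an unsorted family. *)
Lemma sum_take_sorted_threshold (R : realDomainType) (s : seq R) (m : nat) :
  (0 < m <= size s)%N -> sorted >=%R s ->
  \sum_(v <- take m s) v =
    m%:R * nth 0 s m.-1 + \sum_(v <- s) Num.max (v - nth 0 s m.-1) 0.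
Proof.
case/andP=> m_gt0 le_ms s_sorted; set t := nth 0 s m.-1.
have lt_ms : (m.-1 < size s)%N by rewrite prednK.
have nth_ge i j : (i <= j < size s)%N -> nth 0 s j <= nth 0 s i.
  case/andP=> le_ij lt_js.
  apply: (sorted_leq_nth ge_trans ge_refl 0 s_sorted) => //.
  by rewrite inE (leq_ltn_trans le_ij).
rewrite -[in X in _ = _ + X](cat_take_drop m s) big_cat /=.
have -> : \sum_(v <- drop m s) Num.max (v - t) 0 = 0.
  rewrite big_seq; apply: big1 => v /(nthP 0)[j].
  rewrite size_drop nth_drop => lt_j <-.
  apply/max_idPr; rewrite subr_le0; apply: nth_ge.
  by rewrite (leq_trans (leq_pred m) (leq_addr _ _)) -ltn_subRL.
have -> : \sum_(v <- take m s) Num.max (v - t) 0 = \sum_(v <- take m s) (v - t).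
  rewrite big_seq [RHS]big_seq; apply: eq_bigr => v /(nthP 0)[j].
  rewrite size_takel // => lt_jm; rewrite nth_take // => <-.
  apply/max_idPl; rewrite subr_ge0; apply: nth_ge.
  by rewrite lt_ms andbT -ltnS prednK.
rewrite big_split /= sumrN big_const_seq count_predT size_takel //.
by rewrite addr0 iter_addr_0 mulr_natl addrCA subrr addr0.
Qed.

(* Any threshold t gives
   [sum_A (v - t) <= sum_A max(v - t, 0) <= sum_S max(v - t, 0)];
   when t is the m-th largest value, the last sum is that of v - t over the m
   largest values. *)
Lemma mean_le_mean_take_sort (R : realFieldType) (T : finType) (f : T -> R)
    (A S : {set T}) (m : nat) :
  A \subset S -> (0 < m <= #|A|)%N ->
  #|A|%:R^-1 * \sum_(k in A) f k <=
    m%:R^-1 * \sum_(v <- take m (sort >=%R [seq f k | k <- enum S])) v.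
Proof.
move=> sAS /andP[m_gt0 le_mA]; set s := sort _ _.
have size_s : size s = #|S| by rewrite size_sort size_map -cardE.
have A_gt0 : (0 < #|A|)%N := leq_trans m_gt0 le_mA.
rewrite sum_take_sorted_threshold; first last.
- exact: (sort_sorted ge_total).
- by rewrite m_gt0 size_s (leq_trans le_mA) ?subset_leq_card.
set t := nth 0 s m.-1.
have -> : \sum_(v <- s) Num.max (v - t) 0 = \sum_(k in S) Num.max (f k - t) 0.
  by rewrite (perm_big _ (permEl (perm_sort _ _))) big_map big_enum.
set P := \sum_(k in S) _.
have P_ge0 : 0 <= P by apply: sumr_ge0 => k _; rewrite le_max lexx orbT.
have leAP : \sum_(k in A) f k <= #|A|%:R * t + P.
  rewrite mulr_natl -lerBlDl -sumr_const -sumrB.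
  apply: (@le_trans _ _ (\sum_(k in A) Num.max (f k - t) 0)).
    by apply: ler_sum => k _; rewrite le_max lexx.
  rewrite /P [leRHS](big_setID A) /= (setIidPr sAS) lerDl.
  by apply: sumr_ge0 => k _; rewrite le_max lexx orbT.
(* The right side is now [t + P / m], while [leAP] bounds the left side by [t + P / #|A|]; it
   remains to use [0 <= P] and [m <= #|A|]. *)
rewrite mulrDr mulKf ?pnatr_eq0 -?lt0n //.
apply: le_trans (_ : #|A|%:R^-1 * (#|A|%:R * t + P) <= _).
  by rewrite ler_wpM2l // invr_ge0 ler0n.
rewrite mulrDr mulKf ?pnatr_eq0 -?lt0n // lerD2l ler_wpM2r //.
by rewrite lef_pV2 ?posrE ?ltr0n // ler_nat.
Qed.

(** The conclusion is an invariant of child steps: the item added to a node [Z] comes after all of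
    [Z], hence after all of [X]. *)
Lemma sc_descendant_after (I : finType) (prec : rel I) (X Y : {set I}) :
  sc_descendant prec X Y ->
  X \subset Y /\ {in Y :\: X, forall i, all_before prec X i}.
Proof.
pose below (Z : {set I}) :=
  X \subset Z /\ {in Z :\: X, forall i, all_before prec X i}.
have below_child Z C : below Z -> sc_child prec Z C -> below C.
  move=> [sXZ Z_after] /existsP[i /and3P[_ /forall_inP Zi /eqP->]].
  split=> [|j]; first by rewrite (subset_trans sXZ) ?subsetUr.
  rewrite !inE => /andP[jX /orP[/eqP->|jZ]].
    by apply/forall_inP => x xX; apply/Zi/(subsetP sXZ).
  by apply: Z_after; rewrite inE jX.
case/existsP=> C /andP[XC /connectP[p path_p ->]].
have: below C by apply: below_child XC; split=> // i; rewrite setDv inE.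
elim: p C path_p {XC} => //= Z p IHp C /andP[CZ path_p] below_C.
exact: IHp path_p (below_child _ _ below_C CZ).
Qed.

Lemma uo_trans_sum (R : realType) (I : finType) (D : uqdb R I) (X : {set I})
    (k : 'I_(dbsize D)) :
  uo_trans X k = \sum_(i in X) uo_trans [set i] k.
Proof.
by rewrite /uo_trans mulr_suml; apply: eq_bigr => i _; rewrite /utility big_set1.
Qed.

Lemma uo_trans1_ge0 (R : realType) (I : finType) (D : uqdb R I) (i : I)
    (k : 'I_(dbsize D)) : 0 <= uo_trans [set i] k.
Proof.
have u_ge0 j : 0 <= item_utility j k.
  by rewrite mulr_ge0 ?ler0n // ltW ?unit_utility_gt0.
by rewrite divr_ge0 ?sumr_ge0.
Qed.

Lemma uo_trans_le_ruo (R : realType) (I : finType) (D : uqdb R I)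
    (prec : rel I) (X Y : {set I}) (k : 'I_(dbsize D)) :
  X \subset Y -> {in Y :\: X, forall i, all_before prec X i} ->
  Y \subset trans k ->
  uo_trans Y k <= uo_trans X k + ruo_trans prec X k.
Proof.
move=> sXY Y_after sYk.
rewrite uo_trans_sum (big_setID X) /= (setIidPr sXY) -uo_trans_sum lerD2l.
(* Extended by 0 to all items, the sums compare term by term: items of [Y :\: X] occur on both
   sides, and the other terms of [ruo_trans] are nonnegative. *)
rewrite big_mkcond /ruo_trans [leRHS]big_mkcond; apply: ler_sum => i _.
case: ifPn => [iYX|_]; last by case: ifP => // _; apply: uo_trans1_ge0.
have [iX iY] : i \notin X /\ i \in Y by apply/andP; rewrite -in_setD.
by rewrite (subsetP sYk) // iX Y_after.
Qed.

Lemma min_count_gt0 (R : realType) (I : finType) (D : uqdb R I) (alpha : R) :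
  0 < alpha -> (0 < min_count D alpha)%N.
Proof.
move=> alpha_gt0; rewrite /min_count absz_gt0 gt_eqF //.
by rewrite ceil_gt0 mulr_gt0 ?ltr0n ?dbsize_gt0.
Qed.

Lemma min_count_le (R : realType) (I : finType) (D : uqdb R I) (alpha : R)
    (n : nat) :
  0 <= alpha -> alpha * (dbsize D)%:R <= n%:R -> (min_count D alpha <= n)%N.
Proof.
move=> alpha_ge0 le_n; rewrite /min_count -lez_nat gez0_abs.
  by rewrite ceil_le_int.
(* A ceiling is nonnegative exactly when its argument exceeds -1. *)
by rewrite ceil_ge0 // (lt_le_trans (ltrN10 _)) ?mulr_ge0 ?ler0n.
Qed.

Theorem mainTheorem1 (R : realType) (I : finType) (D : uqdb R I)
    (alpha beta gamma : R) (prec : rel I) (X : {set I})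
    (alpha_itv : 0 < alpha <= 1)
    (prec_asc : support_ascending D prec)
    (X_neq0 : X != set0)
    (phi_lt : phi_hat D prec alpha X < beta) :
  forall Y : {set I}, sc_descendant prec X Y -> ~~ phuop D alpha beta gamma Y.
Proof.
move=> Y /sc_descendant_after[sXY Y_after]; apply/and3P => -[sc_ge uo_ge _].
have /andP[alpha_gt0 _] := alpha_itv.
have := lt_le_trans phi_lt uo_ge; rewrite ltNge => /negP; apply.
pose v (k : 'I_(dbsize D)) := uo_trans X k + ruo_trans prec X k.
apply: (@le_trans _ _ (#|supporting D Y|%:R^-1 * \sum_(k in supporting D Y) v k)).
  rewrite ler_wpM2l ?invr_ge0 ?ler0n //; apply: ler_sum => k.
  by rewrite inE; apply: uo_trans_le_ruo.
apply: mean_le_mean_take_sort.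
  by apply/subsetP => k; rewrite !inE; apply: subset_trans.
(* The support condition on [Y] is what gives at least [min_count D alpha] transactions to average
   over. *)
by rewrite min_count_gt0 //= min_count_le // ltW.
Qed.
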